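(* Fix integers $q\ge 2$ and $R\ge 1$. There is a constant $C_{q,R}>0$, depending only on $q$ and $R$, such that for all positive integers $m,n$ with $mn$ sufficiently large (in terms of $q$ and $R$), $$\mathcal{L}_q^{(2)}(m,n,R)\le C_{q,R}\,\frac{q^{mn}}{V_q(mn,R)}.$$ Equivalently, $\mathcal{L}_q^{(2)}(m,n,R)\le \mathcal{O}_{q,R}\!\left(\frac{q^{mn}}{V_q(mn,R)}\right)=\mathcal{O}_{q,R}\!\left(\frac{q^{mn}}{(mn)^R}\right)$.
   Context: The alphabet is $\Sigma_q=\mathbb{Z}/q\mathbb{Z}$. For positive integers $M,N$, a doubly periodic $q$-ary array of period $M\times N$ is a tuple $A=(a_{u,v})_{(u,v)\in\mathbb{Z}_M\times\mathbb{Z}_N}$ with $a_{u,v}\in\Sigma_q$; its area is $MN$. For a phase $(i,j)\in\mathbb{Z}_M\times\mathbb{Z}_N$, the $m\times n$ window of $A$ at $(i,j)$ is $A[(i,j);m,n]=(a_{i+r,j+s})_{0\le r<m,\,0\le s<n}\in\Sigma_q^{m\times n}$, with indices reduced modulo $M$ and $N$ respectively. Hamming distance between $m\times n$ arrays is the number of entries in which they differ. $A$ is a $q$-ary $(m\times n,R)$-covering 2D sequence if every $Y\in\Sigma_q^{m\times n}$ is within Hamming distance $R$ of some window $A[(i,j);m,n]$. $\mathcal{L}_q^{(2)}(m,n,R)$ is the minimum of $MN$ over all pairs $(M,N)$ such that some $(m\times n,R)$-covering 2D sequence has period $M\times N$. $V_q(N,R)=\sum_{j=0}^{R}\binom{N}{j}(q-1)^j$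 is the size of a Hamming ball of radius $R$ in $\Sigma_q^N$. Constants implicit in $\mathcal{O}_{q,R}(\cdot)$ depend only on $q$ and $R$. *)

(* Defs.v *)
From HB Require Import structures.
From mathcomp Require Import all_boot all_order all_algebra.
From mathcomp Require Import boolp reals.

Set Implicit Arguments.
Unset Strict Implicit.
Unset Printing Implicit Defensive.

(* The alphabet Z/qZ is 'Z_q, which is the right ring only for 1 < q. *)

Lemma shift_subproof (M : nat) (i : 'I_M) (r : nat) : (i + r) %% M < M.
Proof. by rewrite ltn_pmod // (leq_ltn_trans (leq0n i)). Qed.

(* i + r in Z/MZ; 'I_M is used instead of 'Z_M so that M = 1 is correct. *)
Definition shift (M : nat) (i : 'I_M) (r : nat) : 'I_M :=
  Ordinal (shift_subproof i r).

Definition window (T : Type) (M N : nat) (A : 'M[T]_(M, N)) (m n : nat)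
    (i : 'I_M) (j : 'I_N) : 'M[T]_(m, n) :=
  (\matrix_(r < m, s < n) A (shift i r) (shift j s))%R.

Definition hamming (T : eqType) (m n : nat) (X Y : 'M[T]_(m, n)) : nat :=
  #|[set p : 'I_m * 'I_n | X p.1 p.2 != Y p.1 p.2]|.

Definition covering (q m n R M N : nat) (A : 'M['Z_q]_(M, N)) : Prop :=
  forall Y : 'M['Z_q]_(m, n),
    exists (i : 'I_M) (j : 'I_N), hamming Y (window A m n i j) <= R.

Definition covering_area (q m n R a : nat) : Prop :=
  exists M N : nat, [/\ 0 < M, 0 < N, a = M * N
    & exists A : 'M['Z_q]_(M, N), covering m n R A].

(* Some covering sequence always exists: put all m x n arrays side by side. *)
Lemma covering_area_ex (q m n R : nat) :
  exists a, `[< covering_area q m n R a >].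
Proof.
pose W : finType := 'M['Z_q]_(m, n).
have W0 : 0 < #|W| by apply/card_gt0P; exists (const_mx ord0).
exists (m.+1 * (#|W| * n.+1)); apply/asboolP.
exists m.+1, (#|W| * n.+1); split=> //; first by rewrite muln_gt0 W0.
have kP (v : 'I_(#|W| * n.+1)) : v %/ n.+1 < #|W| by rewrite ltn_divLR.
pose f (Y : W) (u v : nat) : 'Z_q :=
  match insub u, insub v with Some r, Some s => Y r s | _, _ => ord0 end.
exists (\matrix_(u, v) f (enum_val (Ordinal (kP v))) u (v %% n.+1)%N)%R => Y.
have jP : enum_rank Y * n.+1 < #|W| * n.+1 by rewrite ltn_pmul2r.
exists ord0, (Ordinal jP); rewrite /hamming (_ : [set _ | _] = set0) ?cards0 //.
apply/setP => -[r s]; rewrite !inE /= !mxE /=; apply/negbTE; rewrite negbK.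
have sn : s < n.+1 by rewrite ltnS ltnW.
have ltW : enum_rank Y * n.+1 + s < #|W| * n.+1.
  apply: (@leq_trans ((enum_rank Y).+1 * n.+1)).
    by rewrite mulSn addnC ltn_add2r.
  by rewrite leq_pmul2r // ltn_ord.
rewrite (_ : Ordinal _ = enum_rank Y); last first.
  by apply: val_inj; rewrite /= modn_small // divnMDl // divn_small // addn0.
rewrite enum_rankK [(_ + s) %% _]modn_small // modnMDl add0n !modn_small //.
  by rewrite /f !valK.
by rewrite ltnS ltnW.
Qed.

(* Least area MN of a q-ary (m x n, R)-covering 2D sequence. *)
Definition min_area (q m n R : nat) : nat := ex_minn (covering_area_ex q m n R).

Definition ball_size (q N R : nat) : nat :=
  \sum_(j < R.+1) 'C(N, j) * q.-1 ^ j.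

Local Open Scope ring_scope.

(* f = O(g) over positive m, n as mn tends to infinity, for nonnegative f, g.
   The limit is in the product mn: either side may stay bounded. *)
Definition bigO_mn (K : realType) (f g : nat -> nat -> K) : Prop :=
  exists2 C : K, 0 < C & exists B : nat, forall m n : nat,
    (0 < m)%N -> (0 < n)%N -> (B <= m * n)%N -> f m n <= C * g m n.

(* Main.v *)
Require Import Defs.
From mathcomp Require Import all_boot all_order all_algebra.
From mathcomp Require Import reals.
From mathcomp Require Import boolp zify ring.

Set Implicit Arguments.
Unset Strict Implicit.
Unset Printing Implicit Defensive.

Import Order.TTheory GRing.Theory Num.Theory.

(** The rows and columns of an m x n window are read cyclically.  Repeating an
m x n array c twice side by side gives a strip of m rows and 2n columns,
periodic in the vertical direction, in which all mn cyclic rotations of c occur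
as windows.  Hence a set C of arrays such that every array Y has some rotation
within distance R of C yields a covering sequence of area 2mn|C|
([covering_area_unroll]), and it suffices to find such a C of size
O(q^(mn) / (mn)^(R+1)).  One factor mn is gained from the rotations, the other
R factors from a covering code; the two constructions use disjoint sets of
cells, so that they do not interfere.

Rotations: up to transposing (all statements are symmetric in m and n), let
m <= n, so that log(mn) is small compared with n.  Call an array marked when the
horizontal word of length l that starts at a fixed central cell is minimal among
the words that start in a band of 2h columns around it.  Every array has a
marked rotation, namely the one that puts a globally minimal word at the central
cell ([marked_window]).  If the minimum is strict, two marked rotations of the
same array are at least h columns apart, so there are at most n/h of them; if
q^l >= (mn)^2 then ties are too rare to matter.  With h and l proportional to n
this leaves O(q^(mn) / mn) marked arrays ([card_marked]), and being marked
depends only on the left half of the array ([marked_left]).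

Covering code: choose in the right half R disjoint blocks of q^t cells, the
cells of a block being indexed by the vectors v of (Z/q)^t, with q^t of order
mn.  The syndrome of Y has R components in (Z/q)^t, the k-th being the sum of
Y(k,v) v over the cells (k,v) of block k.  Adding 1 at the single cell (k,z)
adds z to component k, so any syndrome is cancelled by changing at most R cells,
while imposing syndrome 0 divides the number of arrays by q^(tR), which is of
order (mn)^R ([syndrome_subset]).  The marked arrays of syndrome 0 are the
wanted set C.

Finally the ball size V_q(N,R) is of order N^R ([ball_size_le],
[ball_size_ge]), so the two forms of the bound agree up to constants. *)

(** * Cyclic rotations *)

Lemma shiftC (M : nat) (i j : 'I_M) : shift i j = shift j i.
Proof. by apply: val_inj; rewrite /= addnC. Qed.

Lemma shiftA (M : nat) (i j : 'I_M) (r : nat) :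
  shift i (shift j r) = shift (shift i j) r.
Proof. by apply: val_inj; rewrite /= modnDmr modnDml addnA. Qed.

Lemma shift_onto (M : nat) (i a : 'I_M) : exists j : 'I_M, shift i j = a.
Proof.
exists (shift a (M - i)); apply: val_inj; rewrite /= modnDmr addnCA subnKC.
  by rewrite modnDr modn_small.
exact: ltnW.
Qed.

Lemma shift_inj (M : nat) (i : 'I_M) : injective (fun r : 'I_M => shift i r).
Proof.
move=> r s /(congr1 val) /= /eqP; rewrite eqn_modDl !modn_small // => /eqP.
exact: val_inj.
Qed.

Lemma shift_inv (M : nat) (i : 'I_M) :
  exists j : 'I_M, forall r : 'I_M, shift (shift i j) r = r.
Proof.
case: (shift_onto (shift i i) i) => j ij; exists j => r.
apply: (@shift_inj _ i); rewrite shiftA.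
by rewrite -[in LHS]shiftA in ij *; rewrite ij.
Qed.

Section Rotation.
Variables (T : Type) (m n : nat).
Implicit Types Y : 'M[T]_(m, n).

Lemma window_window Y (i i' : 'I_m) (j j' : 'I_n) :
  window (window Y m n i j) m n i' j' =
  window Y m n (shift i i') (shift j j').
Proof. by apply/matrixP => r s; rewrite !mxE !shiftA. Qed.

Lemma windowK (i : 'I_m) (j : 'I_n) :
  exists i' j', forall Y, window (window Y m n i j) m n i' j' = Y.
Proof.
case: (shift_inv i) => i' ii'; case: (shift_inv j) => j' jj'.
by exists i', j' => Y; rewrite window_window; apply/matrixP => r s; rewrite mxE ii' jj'.
Qed.

Lemma window_inj (i : 'I_m) (j : 'I_n) :
  injective (fun Y => window Y m n i j).
Proof.
case: (windowK i j) => i' [j' K] Y Z /(congr1 (fun X => window X m n i' j')).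
by rewrite !K.
Qed.

End Rotation.

Lemma hamming_window (T : eqType) (m n : nat) (X Y : 'M[T]_(m, n)) i j :
  hamming (window X m n i j) (window Y m n i j) <= hamming X Y.
Proof.
pose g (p : 'I_m * 'I_n) := (shift i p.1, shift j p.2).
have gI : injective g.
  move=> [a b] [a' b'] e; congr (_, _).
    exact: (shift_inj (congr1 fst e)).
  exact: (shift_inj (congr1 snd e)).
rewrite /hamming -(card_imset _ gI); apply/subset_leq_card/subsetP => p.
by case/imsetP => p0; rewrite !inE !mxE => ? ->.
Qed.

(** * From a set of arrays to a covering sequence *)

(** Window (i, j) of the strip c c is the rotation of c by (i, j); the strips of
the elements of C are put side by side. *)
Lemma covering_area_unroll (q m n R : nat) (C : {set 'M['Z_q]_(m, n)}) :
  0 < m -> 0 < n ->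
  (forall Y, exists2 c, c \in C & exists i j, hamming Y (window c m n i j) <= R) ->
  covering_area q m n R (m * (#|C| * (2 * n))).
Proof.
move=> m0 n0 cov; exists m, (#|C| * (2 * n)).
have C0 : 0 < #|C|.
  by have [c cC _] := cov (const_mx ord0); apply/card_gt0P; exists c.
have n20 : 0 < 2 * n by lia.
split=> //; first by rewrite !muln_gt0 C0.
have kP (v : 'I_(#|C| * (2 * n))) : v %/ (2 * n) < #|C| by rewrite ltn_divLR.
exists (\matrix_(u, v) (enum_val (Ordinal (kP v))) u (Ordinal (ltn_pmod v n0)))%R.
move=> Y; have [c cC [i [j YR]]] := cov Y.
set k := enum_rank_in cC c; have klt : k < #|C| by [].
have blk x : x < 2 * n -> k * (2 * n) + x < #|C| * (2 * n).
  move=> xn; apply: (@leq_trans (k.+1 * (2 * n))); last by rewrite leq_pmul2r.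
  by rewrite mulSn addnC ltn_add2r.
have jlt : j < 2 * n by have := ltn_ord j; lia.
exists i, (Ordinal (blk j jlt)); congr (_ <= R) : YR; congr hamming.
apply/matrixP => r s; rewrite !mxE.
have jsn : j + s < 2 * n by have := ltn_ord j; have := ltn_ord s; lia.
have E : (k * (2 * n) + j + s) %% (#|C| * (2 * n)) = k * (2 * n) + (j + s).
  by rewrite -addnA modn_small // blk.
rewrite (_ : Ordinal _ = k); last first.
  by apply: val_inj; rewrite /= E divnMDl // divn_small // addn0.
rewrite /k enum_rankK_in //; congr (c _ _).
by apply: val_inj; rewrite /= E mulnA modnMDl.
Qed.

Lemma covering_areaC (q m n R a : nat) :
  covering_area q m n R a -> covering_area q n m R a.
Proof.
move=> [M [N [M0 N0 -> [A covA]]]]; exists N, M; rewrite mulnC; split=> //.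
exists (A^T)%R => Y; have [i [j YR]] := covA (Y^T)%R.
exists j, i; apply: leq_trans YR; rewrite /hamming.
pose sw (p : 'I_n * 'I_m) := (p.2, p.1).
have swI : injective sw by move=> [x y] [x' y'] [-> ->].
rewrite -(card_imset _ swI); apply/subset_leq_card/subsetP => p.
by case/imsetP => p0; rewrite !inE !mxE => ? ->.
Qed.

Lemma min_area_le (q m n R a : nat) :
  covering_area q m n R a -> min_area q m n R <= a.
Proof.
by move=> Ca; rewrite /min_area; case: ex_minnP => b _; apply; apply/asboolP.
Qed.

(** * Marked arrays *)

Section Marker.
Variables (T : finType) (m n h l : nat).
Hypotheses (h0 : 0 < h) (hl : 2 * h + l <= n).
Implicit Types Y : 'M[T]_(m, n).

Definition pattern Y (i : 'I_m) (j : 'I_n) : {ffun 'I_l -> T} :=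
  [ffun s : 'I_l => Y i (shift j s)].

Definition key Y i j : nat := enum_rank (pattern Y i j).

Lemma key_window Y i j a b :
  key (window Y m n i j) a b = key Y (shift i a) (shift j b).
Proof.
congr (enum_rank _ : nat); apply/ffunP => s; rewrite !ffunE !mxE.
by rewrite shiftA; congr (Y _ _); apply: val_inj.
Qed.

(** Each symbol of the word at (a2, b2) is determined by a cell outside this word
or by an earlier symbol of it; so an array with equal words is recovered from
its other cells, and the l cells of the word can be overwritten freely. *)
Lemma card_pattern_eq (a1 a2 : 'I_m) (b1 b2 : 'I_n) :
  b1 + l <= n -> b2 + l <= n -> (a1 != a2) || (b1 < b2) ->
  #|[set Y | pattern Y a1 b1 == pattern Y a2 b2]| * #|T| ^ l <= #|T| ^ (m * n).
Proof.
move=> b1n b2n ab; set E := [set Y | _].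
pose over (u : 'M[T]_(m, n) * {ffun 'I_l -> T}) : 'M[T]_(m, n) :=
  (\matrix_(i, j) if (i == a2) && (b2 <= j)%N then
     if insub (j - b2)%N is Some s then u.2 s else u.1 i j else u.1 i j)%R.
have shE (b : 'I_n) (s : 'I_l) : b + l <= n -> shift b s = b + s :> nat.
  by move=> bn; rewrite /= modn_small //; have := ltn_ord s; lia.
have -> : #|E| * #|T| ^ l = #|setX E [set: {ffun 'I_l -> T}]|.
  by rewrite cardsX cardsT card_ffun card_ord.
rewrite -card_mx -(@card_in_imset _ _ over) ?max_card // => -[Y z] [Y' z'].
rewrite !inE !andbT /= => /eqP YE /eqP YE' /matrixP eo.
have zz : z = z'.
  apply/ffunP => s; have := eo a2 (shift b2 s); rewrite !mxE eqxx.
  by rewrite shE // leq_addr addKn valK.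
have out i (j : 'I_n) : ~~ [&& i == a2, b2 <= j & j - b2 < l] -> Y i j = Y' i j.
  move=> nij; have := eo i j; rewrite !mxE; case: ifP => // /andP[ia bj].
  by rewrite ia bj /= in nij; rewrite insubN.
(* The word at (a2, b2) is recovered from left to right: its k-th symbol equals
   the k-th symbol at (a1, b1), which is outside the word or, when the two words
   overlap, at an index k' < k of it. *)
have ins k (kl : k < l) : Y a2 (shift b2 k) = Y' a2 (shift b2 k).
  elim/ltn_ind: k kl => k IH kl.
  have eY : Y a2 (shift b2 k) = Y a1 (shift b1 k).
    by move/ffunP/(_ (Ordinal kl)): YE; rewrite !ffunE.
  have eY' : Y' a2 (shift b2 k) = Y' a1 (shift b1 k).
    by move/ffunP/(_ (Ordinal kl)): YE'; rewrite !ffunE.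
  rewrite eY eY'; have s1 := shE b1 (Ordinal kl) b1n; rewrite /= in s1.
  case: (boolP [&& a1 == a2, b2 <= shift b1 k & shift b1 k - b2 < l]); last exact: out.
  case/and3P => /eqP aa; rewrite /= s1 => b2k kbl.
  rewrite aa eqxx /= in ab; have k'k : b1 + k - b2 < k by lia.
  have := IH _ k'k kbl; suff -> : shift b2 (b1 + k - b2) = shift b1 k by rewrite aa.
  by apply: val_inj; rewrite /= subnKC.
congr (_, _) => //; apply/matrixP => i j.
case: (boolP [&& i == a2, b2 <= j & j - b2 < l]); last exact: out.
case/and3P => /eqP-> b2j jl; rewrite (_ : j = shift b2 (j - b2)); first exact: ins.
by apply: val_inj; rewrite /= subnKC // modn_small.
Qed.

Variables (i0 : 'I_m) (j0 : 'I_n).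
Hypothesis j0h : j0 = h :> nat.

(** The central cell (i0, j0) is in column h, so that the band of columns below
2h surrounds it by h columns on each side and no word that starts in the band
wraps around. *)
Definition marked : {set 'M[T]_(m, n)} :=
  [set Y | [forall a : 'I_m, forall b : 'I_n,
     (b < 2 * h) ==> (key Y i0 j0 <= key Y a b)]].

Definition strictly_marked : {set 'M[T]_(m, n)} :=
  [set Y | [forall a : 'I_m, forall b : 'I_n,
     (b < 2 * h) ==> ((a, b) != (i0, j0)) ==> (key Y i0 j0 < key Y a b)]].

Lemma marked_window Y : exists i j, window Y m n i j \in marked.
Proof.
have [[a b] _ min_ab] :=
  @arg_minnP _ (i0, j0) xpredT (fun p => key Y p.1 p.2) isT.
have [i ia] := shift_onto i0 a; have [j jb] := shift_onto j0 b.
exists i, j; rewrite inE; apply/forallP => a'; apply/forallP => b'.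
apply/implyP => _; rewrite !key_window (shiftC i) (shiftC j) ia jb.
exact: (min_ab (_, _)).
Qed.

Lemma marked_left Y Y' :
  (forall i (j : 'I_n), j < 2 * h + l -> Y i j = Y' i j) ->
  Y \in marked -> Y' \in marked.
Proof.
move=> eY; rewrite !inE => /forallP mY; apply/forallP => a; apply/forallP => b.
have eK a' (b' : 'I_n) : b' < 2 * h -> key Y a' b' = key Y' a' b'.
  move=> b'h; congr (enum_rank _ : nat); apply/ffunP => s; rewrite !ffunE eY //=.
  have := ltn_ord s => sl; rewrite modn_small; lia.
apply/implyP => bh; rewrite -!eK //; last by rewrite j0h; lia.
by have /forallP/(_ b)/implyP := mY a; apply.
Qed.

(** Two columns in the same block of h columns differ by less than h, so each of
the two central cells lies in the band of the other. *)
Lemma strictly_marked_lt Y (i i' : 'I_m) (j j' : 'I_n) :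
  (i, j) != (i', j') -> j %/ h = j' %/ h ->
  window Y m n i j \in strictly_marked ->
  key Y (shift i i0) (shift j j0) < key Y (shift i' i0) (shift j' j0).
Proof.
move=> ne ejj; rewrite inE => /forallP sm.
have [a ia] := shift_onto i (shift i' i0).
have jj1 := divn_eq j h; have jj2 := divn_eq j' h.
have r1 := ltn_pmod j h0; have r2 := ltn_pmod j' h0.
rewrite -ejj in jj2; have j1 : j < h + j' by lia.
have j2 : j' < h + j by lia.
have bh : h + j' - j < 2 * h by lia.
have bn : h + j' - j < n by lia.
have := sm a => /forallP/(_ (Ordinal bn)); rewrite !key_window /= bh /=.
have -> : shift j (Ordinal bn) = shift j' j0.
  by apply: val_inj; rewrite /= j0h; congr (_ %% _); clear -j1; lia.
rewrite ia => /implyP; apply; apply: contra ne => /eqP[aa bb].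
have ii : i = i'.
  by apply: (@shift_inj _ i0); rewrite -!(shiftC _ i0) -aa ia aa.
have -> : j = j' by apply: val_inj => /=; move: bb => /(congr1 val) /=; clear -j1 j2 j0h; lia.
by rewrite ii.
Qed.

(** Double counting of the pairs (Y, p) such that the rotation of Y by p is
strictly marked: rotations are bijections, so there are |strictly_marked| mn
pairs, and each Y is in at most one pair for each block of h columns. *)
Lemma card_strictly_marked k : n <= k * h ->
  #|strictly_marked| * (m * n) <= k * #|T| ^ (m * n).
Proof.
move=> nk; have k0 : 0 < k by have := ltn_ord j0; case: (k) nk => //; lia.
have sat Y : #|[set p | window Y m n p.1 p.2 \in strictly_marked]| <= k.
  have blkP (p : 'I_m * 'I_n) : p.2 %/ h < k.
    by rewrite ltn_divLR // (leq_trans _ nk).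
  rewrite -[leqRHS]card_ord -(@card_in_imset _ _ (fun p => Ordinal (blkP p))).
    by rewrite max_card.
  move=> [i j] [i' j'] s1 s2 [ejj].
  rewrite in_set /= in s1; rewrite in_set /= in s2.
  apply/eqP; apply: contraT => ne.
  have := strictly_marked_lt ne ejj s1; rewrite eq_sym in ne.
  by have := strictly_marked_lt ne (esym ejj) s2; lia.
have -> : #|strictly_marked| * (m * n) =
    \sum_(p : 'I_m * 'I_n) #|[set Y | window Y m n p.1 p.2 \in strictly_marked]|.
  rewrite (eq_bigr (fun=> #|strictly_marked|)).
    by rewrite sum_nat_const card_prod !card_ord mulnC.
  move=> p _; rewrite -(@on_card_preimset _ _ (fun Y => window Y m n p.1 p.2) strictly_marked).
    by apply: eq_card => Y; rewrite [LHS]in_set [RHS]in_set.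
  exact/onW_bij/injF_bij/window_inj.
under eq_bigr => p _ do rewrite -sum1dep_card big_mkcond.
rewrite exchange_big /=; under eq_bigr => Y _ do rewrite -big_mkcond sum1dep_card.
apply: (@leq_trans (\sum_(Y : 'M[T]_(m, n)) k)).
  by apply: leq_sum => Y _; apply: sat.
by rewrite sum_nat_const card_mx mulnC.
Qed.

(** A marked array is strictly marked or has a tie in the band.  There are at
most mn places for a tie, each with probability at most |T|^-l, so the second
condition makes the ties contribute at most |T|^(mn) / (mn) arrays. *)
Lemma card_marked k : n <= k * h -> (m * n) ^ 2 <= #|T| ^ l ->
  #|marked| * (m * n) <= k.+1 * #|T| ^ (m * n).
Proof.
have j0l : j0 + l <= n by lia.
have bl (b : 'I_n) : b < 2 * h -> b + l <= n by lia.
move=> nk mnl.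
pose tie (p : 'I_m * 'I_n) := [set Y | pattern Y i0 j0 == pattern Y p.1 p.2].
pose D := [set p : 'I_m * 'I_n | (p != (i0, j0)) && (p.2 < 2 * h)].
have sub : marked \subset strictly_marked :|: \bigcup_(p in D) tie p.
  apply/subsetP => Y; rewrite !inE => /forallP mY; apply/orP.
  case: (boolP [exists p in D, Y \in tie p]) => [/exists_inP[p pD Yp]|nt].
    by right; apply/bigcupP; exists p.
  left; apply/forallP => a; apply/forallP => b; apply/implyP => bh.
  apply/implyP => ne; rewrite ltn_neqAle.
  have /forallP/(_ b)/implyP-> // := mY a; rewrite andbT.
  apply: contra nt => /eqP/val_inj/enum_rank_inj e; apply/exists_inP.
  by exists (a, b); rewrite !inE ?ne //= e.
have tie_le p : p \in D -> #|tie p| * #|T| ^ l <= #|T| ^ (m * n).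
  case: p => a b; rewrite inE /= => /andP[ne bh].
  case: (boolP ((i0 != a) || (j0 < b))) => [ab|].
    by apply: card_pattern_eq => //; apply: bl.
  rewrite negb_or negbK -leqNgt => /andP[/eqP ia bj].
  have -> : tie (a, b) = [set Y | pattern Y a b == pattern Y i0 j0].
    by apply/setP => Y; rewrite !inE eq_sym.
  apply: card_pattern_eq => //; first exact: bl.
  rewrite ltn_neqAle bj andbT orbC; apply/orP; left.
  by apply: contra ne => /eqP/val_inj->; rewrite ia.
have card_sum : #|marked| <= #|strictly_marked| + \sum_(p in D) #|tie p|.
  apply: leq_trans (subset_leq_card sub) _; apply: leq_trans (leq_card_setU _ _) _.
  rewrite leq_add2l; elim/big_rec2: _ => [|p s A _ IH]; first by rewrite cards0.
  by apply: leq_trans (leq_card_setU _ _) _; rewrite leq_add2l.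
have T0 : 0 < #|T| ^ l by apply: leq_trans mnl; rewrite expn_gt0; have := ltn_ord j0; have := ltn_ord i0; nia.
have tsum : (\sum_(p in D) #|tie p|) * #|T| ^ l <= (m * n) * #|T| ^ (m * n).
  rewrite big_distrl /=; apply: (@leq_trans (\sum_(p in D) #|T| ^ (m * n))).
    by apply: leq_sum => p; apply: tie_le.
  rewrite sum_nat_const leq_mul2r; apply/orP; right.
  by apply: leq_trans (max_card _) _; rewrite card_prod !card_ord.
have tsum' : (\sum_(p in D) #|tie p|) * (m * n) <= #|T| ^ (m * n).
  rewrite -(leq_pmul2r T0) mulnAC; apply: leq_trans (leq_mul tsum (leqnn _)) _.
  by rewrite mulnAC mulnC leq_mul2l mnl orbT.
have := card_strictly_marked nk; move: card_sum tsum'.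
set s := \sum_(_ in _) _; set Q := #|T| ^ _.
move: #|marked| #|strictly_marked| (m * n) => x y mn; nia.
Qed.

End Marker.

(** * A covering code on prescribed cells *)

Section Syndrome.
Variables (F : finNzRingType) (m n R t : nat).
Variable S : {set 'I_m * 'I_n}.
Hypothesis S_large : R * #|F| ^ t <= #|S|.
Local Open Scope ring_scope.
Implicit Types Y : 'M[F]_(m, n).

Lemma cells_inj : exists2 pos : 'I_R * 'rV[F]_t -> 'I_m * 'I_n,
  injective pos & forall x, pos x \in S.
Proof.
have le : (#|{: 'I_R * 'rV[F]_t}| <= #|S|)%N.
  by rewrite card_prod card_ord card_mx mul1n.
exists (fun x => enum_val (widen_ord le (enum_rank x))); last first.
  by move=> x; apply: enum_valP.
move=> x y /enum_val_inj/(congr1 val) /= /val_inj; exact: enum_rank_inj.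
Qed.

(** If membership in P is not affected by the cells of S, then P has a sparse
subset of covering radius at most R in P.  In the proof, bump Y z adds 1 at one
cell of each block and thereby adds z to the syndrome.  The same operation gives
both halves: with z the opposite of the syndrome it moves Y into the code, and
as z varies it sends the code injectively to disjoint subsets of P. *)
Lemma syndrome_subset (P : {set 'M[F]_(m, n)}) :
  (forall Y Y', (forall i j, (i, j) \notin S -> Y i j = Y' i j) ->
     Y \in P -> Y' \in P) ->
  exists C : {set 'M[F]_(m, n)},
    (#|C| * (#|F| ^ t) ^ R <= #|P|)%N /\
    forall Y, Y \in P -> exists2 c, c \in C & (hamming Y c <= R)%N.
Proof.
move=> PS; have [pos posI posS] := cells_inj.
pose syn Y : {ffun 'I_R -> 'rV[F]_t} :=
  [ffun k => \sum_v Y (pos (k, v)).1 (pos (k, v)).2 *: v].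
pose bump Y (z : {ffun 'I_R -> 'rV[F]_t}) : 'M[F]_(m, n) :=
  \matrix_(i, j) (Y i j + [exists k, pos (k, z k) == (i, j)]%:R).
have synD Y z : syn (bump Y z) = syn Y + z.
  apply/ffunP => k; rewrite !ffunE.
  rewrite [X in _ = _ + X](_ : _ = \sum_(v : 'rV[F]_t) (z k == v)%:R *: v); last first.
    rewrite (bigD1 (z k)) //= eqxx scale1r big1 ?addr0 // => v.
    by rewrite eq_sym => /negbTE->; rewrite scale0r.
  rewrite -big_split; apply: eq_bigr => v _; rewrite mxE scalerDl -surjective_pairing.
  congr (_ + _%:R *: _); congr nat_of_bool; apply/existsP/eqP => [[k' /eqP/posI[->]] //|<-].
  by exists k.
have bumpP Y z : Y \in P -> bump Y z \in P.
  apply: PS => i j ijS; rewrite mxE (_ : [exists _, _] = false) ?addr0 //.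
  by apply/existsP => -[k /eqP e]; rewrite -e posS in ijS.
have bump_near Y z : (hamming Y (bump Y z) <= R)%N.
  rewrite -[leqRHS]card_ord /hamming.
  apply: leq_trans (leq_imset_card (fun k => pos (k, z k)) _).
  apply/subset_leq_card/subsetP => -[i j]; rewrite !inE /= mxE.
  apply: contraR => nim; rewrite (_ : [exists _, _] = false) ?addr0 //.
  by apply/existsP => -[k /eqP e]; rewrite -e imset_f in nim.
exists [set Y in P | syn Y == 0%R]; split=> [|Y YP]; last first.
  by exists (bump Y (- syn Y)); rewrite // inE bumpP //= synD subrr.
have -> : (#|[set Y in P | syn Y == 0%R]| * (#|F| ^ t) ^ R =
    #|setX [set Y in P | syn Y == 0%R] [set: {ffun 'I_R -> 'rV[F]_t}]|)%N.
  by rewrite cardsX cardsT card_ffun card_ord card_mx mul1n.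
rewrite -(@card_in_imset _ _ (fun u => bump u.1 u.2)).
  apply/subset_leq_card/subsetP => _ /imsetP[[Y z] + ->].
  by rewrite !inE /= => /andP[/andP[YP _] _]; apply: bumpP.
move=> [Y z] [Y' z']; rewrite !inE /= !andbT => /andP[_ /eqP s0] /andP[_ /eqP s0'] e.
have zz : z = z' by have := congr1 syn e; rewrite !synD s0 s0' !add0r.
rewrite zz in e *; congr (_, _); apply/matrixP => i j.
by move/matrixP/(_ i j): e; rewrite !mxE => /addIr.
Qed.

End Syndrome.

(** * The bound on the least area *)

Lemma card_right_cells m n w :
  #|[set p : 'I_m * 'I_n | w <= p.2]| = m * (n - w).
Proof.
have -> : [set p : 'I_m * 'I_n | w <= p.2] = setX setT [set j : 'I_n | w <= j].
  by apply/setP => p; rewrite !inE.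
rewrite cardsX cardsT card_ord -sum1dep_card; congr (m * _).
rewrite -[RHS]muln1 -sum_nat_const_nat.
by rewrite (big_geq_mkord _ _ xpredT).
Qed.

Lemma linear_le_expn2 j : 7 <= j -> 16 * j + 16 <= 2 ^ j.
Proof.
elim: j => // j IH; rewrite leq_eqVlt => /orP[/eqP<- //|j7].
by have := IH j7; rewrite expnS; lia.
Qed.

(** Everything is measured by j = n / 16: the band has half-width h = 2j, the
words have length l = 4j, hence marks use 8j <= n/2 columns.  There are at most
16 blocks of h columns in n, and (mn)^2 <= n^4 <= (2^j)^4 <= q^l. *)
Lemma min_area_bound_wide q R m n t :
  1 < q -> 0 < m -> m <= n -> 112 <= n -> 2 * R * q ^ t <= m * n ->
  min_area q m n R * (q ^ t) ^ R <= 34 * q ^ (m * n).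
Proof.
move=> q1 m0 mn n112 tmn; pose j := n %/ 16.
have jn : 16 * j <= n by rewrite mulnC leq_divM.
have nj : n < 16 * j + 16 by rewrite /j; lia.
have j7 : 7 <= j by lia.
have cq : #|'Z_q| = q by rewrite card_ord Zp_cast.
have h0 : 0 < 2 * j by lia.
have hl : 2 * (2 * j) + 4 * j <= n by lia.
have hn : 2 * j < n by lia.
pose i0 := Ordinal m0; pose j0 := Ordinal hn.
pose P := @marked 'Z_q m n (2 * j) (4 * j) i0 j0.
have cP : #|P| * (m * n) <= 17 * q ^ (m * n).
  rewrite -[X in _ * X ^ _]cq; apply: card_marked => //; first by lia.
  apply: (@leq_trans ((n ^ 2) ^ 2)); first by rewrite leq_exp2r // -mulnn leq_mul.
  rewrite -expnM (mulnC 4) [leqRHS]expnM (_ : 2 * 2 = 4) // leq_exp2r //.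
  apply: (@leq_trans (2 ^ j)); first by have := linear_le_expn2 j7; lia.
  by rewrite leq_exp2r ?cq //; lia.
have S_large : R * #|'Z_q| ^ t <= #|[set p : 'I_m * 'I_n | 8 * j <= p.2]|.
  rewrite card_right_cells cq.
  have : n <= 2 * (n - 8 * j) by lia.
  move: (n - _) => x nx; have : m * n <= m * (2 * x) by rewrite leq_mul2l nx orbT.
  by clear -tmn; lia.
have [|C [cC covC]] := syndrome_subset S_large (P := P).
  move=> Y Y' eY; apply: (marked_left h0 hl) => // i k kj; apply: eY.
  by rewrite inE /= -ltnNge; clear -kj; lia.
have area : covering_area q m n R (m * (#|C| * (2 * n))).
  apply: covering_area_unroll => //; first by lia.
  move=> Y; have [i [k YP]] := @marked_window 'Z_q m n (2 * j) (4 * j) i0 j0 Y.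
  have [c cin Yc] := covC _ YP; exists c => //.
  have [i' [k' K]] := windowK 'Z_q i k; exists i', k'.
  by rewrite -[Y in hamming Y _]K; apply: leq_trans (hamming_window _ _ _ _) Yc.
rewrite cq in cC.
apply: leq_trans (leq_mul (min_area_le area) (leqnn _)) _.
apply: (@leq_trans (2 * (#|P| * (m * n)))).
  rewrite (_ : _ * _ = 2 * (m * n) * (#|C| * (q ^ t) ^ R)); last by ring.
  by rewrite -!mulnA leq_mul2l /= mulnA [leqRHS]mulnC leq_mul2l cC orbT.
by apply: leq_trans (leq_mul (leqnn 2) cP) _; rewrite mulnA.
Qed.

Lemma min_areaC q m n R : min_area q m n R = min_area q n m R.
Proof.
have le a b : min_area q a b R <= min_area q b a R.
  apply: min_area_le; apply: covering_areaC; rewrite /min_area.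
  by case: ex_minnP => c /asboolP.
by apply/eqP; rewrite eqn_leq !le.
Qed.

(** With t maximal such that 2 R q^t <= mn, the power q^t is at least
mn / (2Rq). *)
Lemma min_area_bound q R m n :
  1 < q -> 0 < R -> 112 ^ 2 + 2 * R <= m * n ->
  min_area q m n R * (m * n) ^ R <= 34 * (2 * R * q) ^ R * q ^ (m * n).
Proof.
move=> q1 R0 mnB; have R20 : 0 < 2 * R by lia.
wlog mn : m n mnB / m <= n => [H|].
  have [/H->//|/ltnW nm] := leqP m n.
  by rewrite min_areaC (mulnC m); apply: H => //; rewrite (mulnC n).
have m0 : 0 < m by case: (m) mnB => //; rewrite mul0n; lia.
have n112 : 112 <= n.
  rewrite leqNgt; apply/negP => n112; have : m * n <= 112 ^ 2; last by lia.
  by rewrite -mulnn leq_mul //; lia.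
pose t := trunc_log q (m * n %/ (2 * R)).
have d0 : 0 < m * n %/ (2 * R) by rewrite divn_gt0 //; lia.
have tmn : 2 * R * q ^ t <= m * n.
  by rewrite mulnC -leq_divRL // trunc_logP.
have mnt : m * n <= 2 * R * q * q ^ t.
  have := trunc_log_ltn (m * n %/ (2 * R)) q1.
  by rewrite ltn_divLR // -/t expnS => /ltnW; rewrite [leqRHS]mulnC mulnA.
apply: (@leq_trans (min_area q m n R * (2 * R * q * q ^ t) ^ R)).
  by rewrite leq_mul2l leq_exp2r // mnt orbT.
rewrite expnMn mulnCA [leqLHS]mulnC [leqRHS]mulnAC leq_mul2r.
by rewrite min_area_bound_wide ?orbT.
Qed.

(** * The size of a Hamming ball *)

Lemma ffact_le N j : N ^_ j <= N ^ j.
Proof.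
elim: j => // j IH; rewrite ffactnSr expnSr; apply: leq_mul => //.
exact: leq_subr.
Qed.

Lemma ball_size_le q N R : 0 < q -> 0 < N ->
  ball_size q N R <= R.+1 * q ^ R * N ^ R.
Proof.
move=> q0 N0; rewrite /ball_size -mulnA.
rewrite -[R.+1 in leqRHS]card_ord -sum_nat_const; apply: leq_sum => j _.
rewrite mulnC; apply: leq_mul.
  apply: (@leq_trans (q ^ j)); last by rewrite leq_pexp2l // -ltnS.
  by case: (j : nat) => // k; rewrite leq_exp2r // leq_pred.
apply: (@leq_trans (N ^ j)); last by rewrite leq_pexp2l // -ltnS.
apply: leq_trans (ffact_le N j); rewrite -bin_ffact.
by rewrite leq_pmulr // fact_gt0.
Qed.

Lemma ball_size_ge q N R : 1 < q -> 2 * R <= N ->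
  N ^ R <= 2 ^ R * R`! * ball_size q N R.
Proof.
move=> q1 RN.
(* Each factor N - j of the falling factorial is at least N / 2. *)
have ff j : j <= R -> N ^ j <= 2 ^ j * N ^_ j.
  elim: j => // j IH jR; rewrite ffactnSr !expnSr.
  have := leq_mul (IH (ltnW jR)) (_ : N <= 2 * (N - j)); rewrite mulnACA; apply.
  by lia.
apply: leq_trans (ff R (leqnn R)) _; rewrite -mulnA leq_mul2l; apply/orP; right.
rewrite -bin_ffact mulnC leq_mul2l; apply/orP; right.
rewrite /ball_size (bigD1 ord_max) //=; apply: leq_trans (leq_addr _ _).
by rewrite leq_pmulr // expn_gt0; case: (q) q1 => [|[|]].
Qed.

(** * The theorem *)

Local Open Scope ring_scope.

Theorem mainTheorem2 (K : realType) (q R : nat) (hq : (2 <= q)%N)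
    (hR : (1 <= R)%N) :
  let L := fun m n : nat => (min_area q m n R)%:R : K in
  let f := fun m n : nat =>
    q%:R ^+ (m * n) / (ball_size q (m * n) R)%:R : K in
  let g := fun m n : nat => q%:R ^+ (m * n) / (m * n)%:R ^+ R : K in
  [/\ exists2 C : K, 0 < C & exists B : nat, forall m n : nat,
        (0 < m)%N -> (0 < n)%N -> (B <= m * n)%N -> L m n <= C * f m n,
      bigO_mn L g & bigO_mn f g /\ bigO_mn g f].
Proof.
move=> L f g.
have ratio (Q x y c : nat) : (0 < x)%N -> (0 < y)%N -> (y <= c * x)%N ->
    Q%:R / x%:R <= c%:R * (Q%:R / y%:R) :> K.
  move=> x0 y0 yx; rewrite ler_pdivrMr ?ltr0n // mulrA mulrAC ler_pdivlMr ?ltr0n //.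
  by rewrite -!natrM ler_nat mulnAC [leqRHS]mulnC leq_mul2l yx orbT.
have fE m n : f m n = (q ^ (m * n))%:R / (ball_size q (m * n) R)%:R.
  by rewrite /f natrX.
have gE m n : g m n = (q ^ (m * n))%:R / ((m * n) ^ R)%:R.
  by rewrite /g !natrX.
have ball0 N : (2 * R <= N)%N -> (0 < ball_size q N R)%N.
  move=> RN; have := ball_size_ge hq RN; case: (ball_size _ _ _) => //.
  by rewrite muln0 leqn0 expn_eq0; case: N RN => // N; lia.
pose cL := (34 * (2 * R * q) ^ R)%N.
have cL0 : (0 < cL)%N by rewrite muln_gt0 expn_gt0 !muln_gt0 hR; lia.
pose cf := (2 ^ R * R`!)%N.
have cf0 : (0 < cf)%N by rewrite muln_gt0 expn_gt0 fact_gt0.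
have Lg m n : (112 ^ 2 + 2 * R <= m * n)%N -> L m n <= cL%:R * g m n.
  move=> mnB; have mn0 : (0 < (m * n) ^ R)%N by rewrite expn_gt0; lia.
  rewrite gE mulrA ler_pdivlMr ?ltr0n // -!natrM ler_nat.
  exact: min_area_bound.
have fg m n : (2 * R <= m * n)%N -> f m n <= cf%:R * g m n.
  move=> mnR; rewrite fE gE; apply: ratio; [exact: ball0 | | exact: ball_size_ge].
  by rewrite expn_gt0; lia.
have gf m n : (2 * R <= m * n)%N -> g m n <= (R.+1 * q ^ R)%:R * f m n.
  move=> mnR; rewrite fE gE; apply: ratio; [by rewrite expn_gt0; lia | exact: ball0 |].
  by apply: ball_size_le; lia.
have cg0 : (0 < R.+1 * q ^ R)%N by rewrite muln_gt0 expn_gt0; lia.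
split; [| |split].
- exists (cL%:R * (R.+1 * q ^ R)%:R); first by rewrite mulr_gt0 ?ltr0n.
  exists (112 ^ 2 + 2 * R)%N => m n _ _ mnB.
  rewrite -mulrA; apply: le_trans (Lg _ _ mnB) _.
  by rewrite ler_wpM2l ?ler0n // gf //; lia.
- exists cL%:R; first by rewrite ltr0n.
  by exists (112 ^ 2 + 2 * R)%N => m n _ _; apply: Lg.
- exists cf%:R; first by rewrite ltr0n.
  by exists (2 * R)%N => m n _ _; apply: fg.
- exists (R.+1 * q ^ R)%:R; first by rewrite ltr0n.
  by exists (2 * R)%N => m n _ _; apply: gf.
Qed.
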